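(* Let $G$ be a finite simple graph on $[n]$ and let $K$ be a field with $\operatorname{char}(K)=2$. Then $L_G$ is a radical ideal of $K[x_1,\ldots,x_n,y_1,\ldots,y_n]$ if and only if $G$ is bipartite.
   Context: For a finite simple graph $G$ on $[n]=\{1,\ldots,n\}$ with edge set $E(G)$ and a field $K$, $L_G=(x_ix_j+y_iy_j : \{i,j\}\in E(G))\subset K[x_1,\ldots,x_n,y_1,\ldots,y_n]$. *)

(* Defs.v *)
From HB Require Import structures.
From mathcomp Require Import all_boot all_order all_algebra.
From mathcomp Require Import mpoly.

Set Implicit Arguments.
Unset Strict Implicit.
Unset Printing Implicit Defensive.

Import GRing.Theory.
Local Open Scope ring_scope.

(* A finite simple graph on V is given by its adjacency relation; multinomials
   shadows the name symmetric. *)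
Definition simple_graph (V : finType) (G : rel V) : Prop :=
  ssrbool.symmetric G /\ irreflexive G.

(* A and its complement are the two parts, either of which may be empty. *)
Definition bipartite (V : finType) (G : rel V) : Prop :=
  exists A : {set V}, forall i j, G i j -> (i \in A) != (j \in A).

Definition ideal_gen (R : comNzRingType) (S : R -> Prop) (p : R) : Prop :=
  exists (m : nat) (a s : 'I_m -> R),
    (forall k, S (s k)) /\ p = \sum_(k < m) a k * s k.

Definition radical_ideal (R : comNzRingType) (I : R -> Prop) : Prop :=
  forall (p : R) (k : nat), I (p ^+ k) -> I p.

(* K[x_1, .., x_n, y_1, .., y_n] is {mpoly K[n + n]}: the first n variables
   are the x_i and the last n are the y_i. *)
Definition xvar (K : fieldType) (n : nat) (i : 'I_n) : {mpoly K[n + n]} :=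
  'X_(lshift n i).

Definition yvar (K : fieldType) (n : nat) (i : 'I_n) : {mpoly K[n + n]} :=
  'X_(rshift n i).

Definition edge_poly (K : fieldType) (n : nat) (i j : 'I_n) :
    {mpoly K[n + n]} :=
  xvar K i * xvar K j + yvar K i * yvar K j.

Definition L_ideal (K : fieldType) (n : nat) (G : rel 'I_n) :
    {mpoly K[n + n]} -> Prop :=
  ideal_gen (fun f => exists i j, G i j /\ f = edge_poly K i j).

Arguments L_ideal K {n} G _.

(* Main.v *)
Require Import Defs.
From mathcomp Require Import all_boot all_order all_algebra.
From mathcomp Require Import mpoly.
From mathcomp Require Import ring zify.

(** Think of a point of the zero set of L_G as a family of plane vectors
    v_i = (x_i, y_i) with v_i orthogonal to v_j along every edge.

    Radical implies bipartite.  Two vectors orthogonal to the same nonzero vector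
    are parallel, so along a walk with nonzero vectors, endpoints at even distance
    are parallel and endpoints at odd distance are orthogonal; algebraically this
    holds modulo L_G after multiplication by a monomial ([connect_walk_poly]).  An
    odd closed walk at i thus puts m (x_i^2 + y_i^2) = m (x_i + y_i)^2 in L_G for
    some monomial m, the square being the effect of characteristic 2.  Radicality
    would give m (x_i + y_i) in L_G.  But the constant family v_i = (1, 1 + eps)
    over K[eps]/(eps^2) satisfies all the equations, and x_i + y_i takes the
    nonzero value eps there while monomials take unit values
    ([radical_no_odd_walk]).  Without odd closed walks, the parity of the walks
    from a root in each component is a bipartition ([no_odd_walk_bipartite]).

    Bipartite implies radical.  Exchanging x_i and y_i outside one part A, that
    is, writing u_i, w_i for the pair so reordered, turns the generators into
    u_i w_j + w_i u_j, which are the 2-minors of the edges up to signs, irrelevant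
    in characteristic 2.  Modulo such a binomial ideal a monomial is an arrangement
    of u- and w-tokens on the vertices, and an edge allows the exchange of a u at
    one end with a w at the other.  If T is the set of occupied vertices, tokens
    can be exchanged between any two vertices in the same component of the induced
    graph G[T] ([path_binomial]), so the class of a monomial is determined by the
    number of tokens on each vertex and the number of u-tokens in each component of
    G[T] ([monomial_congr]).  These data are the exponents of its image under the
    ring morphism phi_T with u_i -> t_i a_C, w_i -> t_i for i in a component C of
    G[T], and u_i, w_i -> 0 for i outside T ([phi_monomial]).  Comparing
    coefficients, L_G is the intersection of the kernels of all phi_T ([phi_L0],
    [mem_L_of_phi0]); the targets are domains, so L_G is radical. *)

Set Implicit Arguments.
Unset Strict Implicit.
Unset Printing Implicit Defensive.

Import GRing.Theory.
Local Open Scope ring_scope.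

(** * Ideals given by generators *)

Section IdealGen.
Variables (R : comNzRingType) (S : R -> Prop).
Implicit Types p q : R.

Lemma ideal_gen0 : ideal_gen S 0.
Proof.
exists 0%N, (fun=> 0), (fun=> 0); split; first by case.
by rewrite big_ord0.
Qed.

Lemma ideal_gen_mem p : S p -> ideal_gen S p.
Proof.
move=> Sp; exists 1%N, (fun=> 1), (fun=> p); split=> //.
by rewrite big_ord1 mul1r.
Qed.

Lemma ideal_genD p q : ideal_gen S p -> ideal_gen S q -> ideal_gen S (p + q).
Proof.
move=> [m1 [a1 [s1 [Ss1 ->]]]] [m2 [a2 [s2 [Ss2 ->]]]].
pose glue (f1 : 'I_m1 -> R) (f2 : 'I_m2 -> R) k :=
  match split k with inl i => f1 i | inr j => f2 j end.
exists (m1 + m2)%N, (glue a1 a2), (glue s1 s2); split.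
  by move=> k; rewrite /glue; case: (split k).
rewrite big_split_ord /=; congr (_ + _); apply: eq_bigr => i _.
  by rewrite /glue (unsplitK (inl i)).
by rewrite /glue (unsplitK (inr i)).
Qed.

Lemma ideal_genMl p q : ideal_gen S q -> ideal_gen S (p * q).
Proof.
move=> [m [a [s [Ss ->]]]]; exists m, (fun k => p * a k), s; split=> //.
by rewrite mulr_sumr; apply: eq_bigr => k _; rewrite mulrA.
Qed.

Lemma ideal_gen_sum (I : eqType) (r : seq I) (F : I -> R) :
  (forall i, i \in r -> ideal_gen S (F i)) -> ideal_gen S (\sum_(i <- r) F i).
Proof.
move=> SF; rewrite big_seq.
apply: (big_ind (ideal_gen S)) => //; first exact: ideal_gen0.
exact: ideal_genD.
Qed.

Lemma ideal_gen_rmorph_dvd (A : comNzRingType) (f : {rmorphism R -> A})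
    (d : A) :
  (forall p, S p -> exists c, f p = c * d) ->
  forall p, ideal_gen S p -> exists c, f p = c * d.
Proof.
move=> fS _ [m [a [s [Ss ->]]]]; rewrite rmorph_sum.
elim/big_ind: _.
- by exists 0; rewrite mul0r.
- by move=> _ _ [c1 ->] [c2 ->]; exists (c1 + c2); rewrite mulrDl.
- move=> k _; have [c fc] := fS _ (Ss k).
  by exists (f (a k) * c); rewrite rmorphM fc mulrA.
Qed.

End IdealGen.

Lemma mpolyDD_char2 (R : nzRingType) (N : nat) (hR : 2%N \in [pchar R])
  (p : {mpoly R[N]}) : p + p = 0.
Proof. by rewrite -mulr2n -scaler_nat pcharf0 // scale0r. Qed.

(** * Finite sums *)

Lemma sum_eq_ltn_exists (I : finType) (P : pred I) (E F : I -> nat) i :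
  (\sum_(k | P k) E k = \sum_(k | P k) F k)%N -> P i -> (E i < F i)%N ->
  exists2 j, P j & (F j < E j)%N.
Proof.
move=> sumEF Pi ltEF; apply/exists_inP; apply: contraPT sumEF.
rewrite negb_exists_in => /forall_inP leEF; apply/eqP; rewrite neq_ltn.
apply/orP; left; rewrite (bigD1 i) //= [ltnRHS](bigD1 i) //= -addSn.
by apply: leq_add => //; apply: leq_sum => k /andP[/leEF]; rewrite -leqNgt.
Qed.

Lemma sum_by_image (V : nmodType) (I J : eqType) (r : seq I) (F : I -> V)
    (h : I -> J) :
  \sum_(i <- r) F i = \sum_(e <- undup (map h r)) \sum_(i <- r | h i == e) F i.
Proof.
under [RHS]eq_bigr do rewrite big_mkcond.
rewrite exchange_big /=; apply: eq_big_seq => i ri.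
rewrite -big_mkcond (eq_bigl (pred1 (h i))) => [|e]; last exact: eq_sym.
by rewrite -big_filter filter_pred1_uniq ?big_seq1 ?undup_uniq // mem_undup map_f.
Qed.

(** * Radical implies bipartite *)

Section OddWalks.
Variables (n : nat) (G : rel 'I_n) (K : fieldType).
Hypotheses (hG : simple_graph G) (hK : 2%N \in [pchar K]).
Local Notation L := (L_ideal K G).
Local Notation x := (@xvar K n).
Local Notation y := (@yvar K n).

(** Saturation by monomials: it makes every variable cancellable, so that
    divisions by coordinates of the vectors v_i become legitimate. *)
Definition monomial_sat (q : {mpoly K[n + n]}) : Prop :=
  exists m, L ('X_[m] * q).

Lemma monomial_sat_mem q : L q -> monomial_sat q.
Proof. by move=> Lq; exists 0%MM; rewrite mpolyX0 mul1r. Qed.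

Lemma monomial_satD p q :
  monomial_sat p -> monomial_sat q -> monomial_sat (p + q).
Proof.
move=> [m1 L1] [m2 L2]; exists (m1 + m2)%MM; rewrite mulrDr; apply: ideal_genD.
  by rewrite mpolyXD [_ * 'X_[m2]]mulrC -mulrA; apply: ideal_genMl.
by rewrite mpolyXD -mulrA; apply: ideal_genMl.
Qed.

Lemma monomial_satMl p q : monomial_sat q -> monomial_sat (p * q).
Proof. by move=> [m Lm]; exists m; rewrite mulrCA; apply: ideal_genMl. Qed.

Lemma monomial_satXl m q : monomial_sat ('X_[m] * q) -> monomial_sat q.
Proof. by move=> [m' Lm]; exists (m' + m)%MM; rewrite mpolyXD -mulrA. Qed.

(** Paths here are walks of G carrying the parity of their length in the boolean:
    a path from (i, false) to (i, true) is an odd closed walk at i. *)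
Definition double_cover : rel ('I_n * bool) :=
  [rel p q | G p.1 q.1 && (p.2 != q.2)].

(** The equation relating the ends of a walk: orthogonality when its length is
    odd, parallelism (the 2-minor, signs being irrelevant) when it is even. *)
Definition walk_poly (odd : bool) i j : {mpoly K[n + n]} :=
  if odd then x i * x j + y i * y j else x i * y j + y i * x j.

(** Induction on the walk, prepending an edge p - r: each equation for p and q,
    multiplied by x_r, is a combination of the edge equation for p, r and the
    equation of opposite parity for r and q. *)
Lemma connect_walk_poly p q : connect double_cover p q ->
  monomial_sat (walk_poly (p.2 (+) q.2) p.1 q.1).
Proof.
case/connectP=> w; elim: w p => [|r w IHw] p /=.
  move=> _ ->; rewrite addbb /= [y _ * _]mulrC (mpolyDD_char2 hK).
  by apply: monomial_sat_mem; apply: ideal_gen0.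
case/andP=> /andP[Gpr neq] /IHw{IHw} IHw /IHw{w}{}IHw.
have Epr : monomial_sat (x p.1 * x r.1 + y p.1 * y r.1).
  by apply/monomial_sat_mem/ideal_gen_mem; exists p.1, r.1.
have cancel2 (a b t : {mpoly K[n + n]}) : a + (t + t) = b -> a = b.
  by rewrite (mpolyDD_char2 hK) addr0.
apply: (@monomial_satXl U_(lshift n r.1)); rewrite -/(x r.1).
have -> : p.2 (+) q.2 = ~~ (r.2 (+) q.2) by case: p.2 r.2 q.2 neq => [] [] [].
move: IHw; rewrite /walk_poly; case: (_ (+) _) => /= IHw.
- suff -> : x r.1 * (x p.1 * y q.1 + y p.1 * x q.1) =
      y q.1 * (x p.1 * x r.1 + y p.1 * y r.1) +
      y p.1 * (x r.1 * x q.1 + y r.1 * y q.1).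
    by apply: monomial_satD; apply: monomial_satMl.
  by apply: (cancel2 _ _ (y p.1 * y q.1 * y r.1)); ring.
- suff -> : x r.1 * (x p.1 * x q.1 + y p.1 * y q.1) =
      x q.1 * (x p.1 * x r.1 + y p.1 * y r.1) +
      y p.1 * (x r.1 * y q.1 + y r.1 * x q.1).
    by apply: monomial_satD; apply: monomial_satMl.
  by apply: (cancel2 _ _ (y p.1 * y r.1 * x q.1)); ring.
Qed.

(** The constant family v_i = (1, 1 + eps), with 'X standing for eps; the relation
    eps^2 = 0 is imposed by reasoning up to multiples of 'X^2. *)
Definition eps_point (k : 'I_(n + n)) : {poly K} :=
  if split k is inl _ then 1 else 1 + 'X.

Local Notation eps_eval := (mmap (@polyC K) eps_point).

Lemma eps_evalx i : eps_eval (x i) = 1.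
Proof. by rewrite mmapX mmap1U /eps_point (unsplitK (inl i)). Qed.

Lemma eps_evaly i : eps_eval (y i) = 1 + 'X.
Proof. by rewrite mmapX mmap1U /eps_point (unsplitK (inr i)). Qed.

Lemma eps_eval_L p : L p -> exists c, eps_eval p = c * 'X^2.
Proof.
have char2 : 2%N \in [pchar {poly K}] by rewrite pchar_poly.
apply: (@ideal_gen_rmorph_dvd _ _ _ eps_eval 'X^2) => _ [i [j [_ ->]]].
exists 1; rewrite /edge_poly !(rmorphM, rmorphD) /= !(eps_evalx, eps_evaly).
have two0 : 2 = 0 :> {poly K} by apply: pcharf0.
have -> : 1 * 1 + (1 + 'X) * (1 + 'X) = 1 * 'X^2 + 2 * (1 + 'X) :> {poly K}.
  by ring.
by rewrite two0 mul0r addr0.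
Qed.

Lemma eps_eval_monomial0 m : (eps_eval 'X_[m]).[0] = 1.
Proof.
rewrite mmapX /mmap1 horner_prod big1 // => k _.
rewrite horner_exp /eps_point.
by case: split => _; rewrite ?hornerE ?addr0 ?expr1n.
Qed.

Lemma radical_no_odd_walk : radical_ideal L ->
  forall i, ~~ connect double_cover (i, false) (i, true).
Proof.
move=> radL i; apply/negP => /connect_walk_poly[m Lm].
have : L ('X_[m] * (x i + y i)).
  apply: (radL _ 2%N).
  have -> : ('X_[m] * (x i + y i)) ^+ 2 = 'X_[m] *
      ('X_[m] * (x i * x i + y i * y i)) + (x i * y i * 'X_[m] ^+ 2 +
      x i * y i * 'X_[m] ^+ 2) by ring.
  by rewrite (mpolyDD_char2 hK) addr0; apply: ideal_genMl.
case/eps_eval_L=> c; rewrite rmorphM rmorphD /= eps_evalx eps_evaly.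
have char2 : 2%N \in [pchar {poly K}] by rewrite pchar_poly.
(* The image of 'X_[m] * (x_i + y_i) has the nonzero coefficient 1 in degree 1. *)
rewrite addrA (addrr_pchar2 char2) add0r => /(congr1 (fun q : {poly K} => q`_1)).
rewrite coefMX coefMXn /= -horner_coef0 eps_eval_monomial0.
by move/eqP; rewrite oner_eq0.
Qed.

Lemma no_odd_walk_bipartite :
  (forall i, ~~ connect double_cover (i, false) (i, true)) -> bipartite G.
Proof.
case: hG => Gsym _ noodd.
have csymG := sym_connect_sym Gsym.
have csymD : connect_sym double_cover.
  by apply: sym_connect_sym => p q; rewrite /double_cover /= Gsym eq_sym.
pose r := fingraph.root G.
have lift v j :
    connect G v j -> exists b, connect double_cover (v, false) (j, b).
  case/connectP=> w; elim/last_ind: w j => [|w k IHw] j /=.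
    by move=> _ ->; exists false.
  rewrite rcons_path last_rcons => /andP[/IHw{}IHw Gk] ->.
  have [b cb] := IHw _ erefl; exists (~~ b); apply: connect_trans cb (connect1 _).
  by rewrite /double_cover /= Gk; case: b.
(* One part consists of the vertices at odd distance from the root. *)
exists [set i | connect double_cover (r i, false) (i, true)] => i j Gij.
have rij : r j = r i by apply/eqP; rewrite root_connect // csymG connect1.
have flip v k l b : G k l -> connect double_cover v (k, b) ->
    connect double_cover v (l, ~~ b).
  move=> Gkl cv; apply: connect_trans cv (connect1 _).
  by rewrite /double_cover /= Gkl; case: b.
rewrite !inE rij; apply/negP => /eqP Eij.
have [ci|nci] := boolP (connect double_cover (r i, false) (i, true)).
  move: Eij; rewrite ci => /esym cj.
  have := noodd j; rewrite -/(is_true _) => /negP; apply.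
  apply: connect_trans cj; rewrite csymD; exact: flip ci.
have cri : connect G (r i) i by rewrite csymG connect_root.
have [[] cb] := lift _ _ cri; first by rewrite cb in nci.
by move: Eij nci; rewrite (flip _ _ _ _ Gij cb) => ->.
Qed.

End OddWalks.

(** * Bipartite implies radical *)

Section Bipartite.
Variables (n : nat) (G : rel 'I_n) (K : fieldType) (A : {set 'I_n}).
Hypotheses (hG : simple_graph G) (hK : 2%N \in [pchar K]).
Hypothesis hA : forall i j, G i j -> (i \in A) != (j \in A).
Local Notation L := (L_ideal K G).
Local Notation P := {mpoly K[n + n]}.
Local Notation M := 'X_{1..n + n}.
Implicit Types (i j c : 'I_n) (k : 'I_(n + n)) (m : M) (T : {set 'I_n}).

(** The positions, among the 2n variables, of u_i and w_i: the pair (x_i, y_i) for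
    i in A, and the pair (y_i, x_i) otherwise. *)
Definition uidx i : 'I_(n + n) := if i \in A then lshift n i else rshift n i.
Definition widx i : 'I_(n + n) := if i \in A then rshift n i else lshift n i.
Definition vertex k : 'I_n := match split k with inl i => i | inr i => i end.

Local Notation u i := ('X_(uidx i) : P).
Local Notation w i := ('X_(widx i) : P).

Lemma vertex_lshift i : vertex (lshift n i) = i.
Proof. by rewrite /vertex (unsplitK (inl i)). Qed.

Lemma vertex_rshift i : vertex (rshift n i) = i.
Proof. by rewrite /vertex (unsplitK (inr i)). Qed.

Lemma vertex_uidx i : vertex (uidx i) = i.
Proof.
by rewrite /uidx; case: ifP => _; rewrite ?vertex_lshift ?vertex_rshift.
Qed.

Lemma vertex_widx i : vertex (widx i) = i.
Proof.
by rewrite /widx; case: ifP => _; rewrite ?vertex_lshift ?vertex_rshift.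
Qed.

Lemma eq_uw i j : (uidx i == widx j) = false.
Proof.
apply/negP => /eqP E; have ij : i = j by rewrite -(vertex_uidx i) E vertex_widx.
move: E; rewrite ij /uidx /widx; case: ifP => _ /eqP.
  by rewrite eq_lrshift.
by rewrite eq_rlshift.
Qed.

Lemma eq_wu i j : (widx i == uidx j) = false.
Proof. by rewrite eq_sym eq_uw. Qed.

Lemma eq_uu i j : (uidx i == uidx j) = (i == j).
Proof. by apply/eqP/eqP => [E|-> //]; rewrite -(vertex_uidx i) E vertex_uidx. Qed.

Lemma eq_ww i j : (widx i == widx j) = (i == j).
Proof. by apply/eqP/eqP => [E|-> //]; rewrite -(vertex_widx i) E vertex_widx. Qed.

Lemma uidx_or_widx k : k = uidx (vertex k) \/ k = widx (vertex k).
Proof.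
rewrite -(splitK k) /unsplit; case: (split k) => i;
  by rewrite ?vertex_lshift ?vertex_rshift /uidx /widx; case: (i \in A); auto.
Qed.

Lemma big_uw (R : Type) (idx : R) (op : Monoid.com_law idx)
    (F : 'I_(n + n) -> R) :
  \big[op/idx]_k F k = \big[op/idx]_i op (F (uidx i)) (F (widx i)).
Proof.
rewrite big_split_ord /= -(big_split op); apply: eq_bigr => i _.
by rewrite /uidx /widx; case: (i \in A); rewrite // Monoid.mulmC.
Qed.

Lemma edge_polyE i j : G i j -> edge_poly K i j = u i * w j + w i * u j.
Proof.
rewrite /edge_poly /xvar /yvar /uidx /widx => /hA.
by case: (i \in A); case: (j \in A) => // _; rewrite addrC.
Qed.

Lemma edge_binomial i j : G i j -> L (u i * w j + w i * u j).
Proof.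
by move=> Gij; apply: ideal_gen_mem; exists i, j; rewrite edge_polyE.
Qed.

Definition vdeg m i := (m (uidx i) + m (widx i))%N.

Definition vsupp m : {set 'I_n} := [set i | (0 < vdeg m i)%N].

Lemma vdegD m1 m2 i : vdeg (m1 + m2)%MM i = (vdeg m1 i + vdeg m2 i)%N.
Proof. by rewrite /vdeg !mnmDE addnACA. Qed.

Lemma vdeg_uidx i j : vdeg U_(uidx i) j = (i == j).
Proof. by rewrite /vdeg !mnm1E eq_uu eq_uw addn0. Qed.

Lemma vdeg_widx i j : vdeg U_(widx i) j = (i == j).
Proof. by rewrite /vdeg !mnm1E eq_ww eq_wu. Qed.

Definition induced T : rel 'I_n := [rel i j | [&& G i j, i \in T & j \in T]].

Lemma induced_sym T : connect_sym (induced T).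
Proof.
apply: sym_connect_sym => i j.
by rewrite /induced /= (proj1 hG) [X in _ && X]andbC.
Qed.

(** A component of G[T] is encoded by a canonical vertex of it, so that it can
    index one of the variables. *)
Definition component T i := fingraph.root (induced T) i.

Lemma mnm_factor m k : (0 < m k)%N -> exists m', m = (m' + U_(k))%MM.
Proof.
move=> mk; exists (m - U_(k))%MM; apply/esym/submK/mnm_lepP => l.
by rewrite mnm1E; case: eqP => // <-.
Qed.

Lemma eqD_char2 (p q t : P) : p + (t + t) = q -> p = q.
Proof. by rewrite (mpolyDD_char2 hK) addr0. Qed.

(** The exchange of tokens between distant vertices i and j.  If k follows i on the
    path, a spare token at k, say u_k, is used as a catalyst:
    u_k (u_i w_j + w_i u_j) = u_i (u_k w_j + w_k u_j) + u_j (u_i w_k + w_i u_k)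
    in characteristic 2.  The first term has the same number of tokens on each
    vertex, which is why the hypothesis counts the tokens of m together with those
    of the binomial: in this form it is preserved along the path. *)
Lemma path_binomial T i j m : connect (induced T) i j ->
  (forall l, l \in T -> (0 < vdeg m l + (i == l) + (j == l))%N) ->
  L ('X_[m] * (u i * w j + w i * u j)).
Proof.
case/connectP=> s; elim: s i m => [|k s IHs] i m /=.
  move=> _ -> _; rewrite [w i * _]mulrC (mpolyDD_char2 hK) mulr0.
  exact: ideal_gen0.
case/andP=> /and3P[Gik _ kT] pks js Tm; have {}IHs := IHs k _ pks js.
have [mk0|] := posnP (vdeg m k).
  have := Tm _ kT; rewrite mk0 add0n.
  have [ik _|_] := eqVneq i k; first by rewrite ik; apply: IHs; rewrite -ik.
  by have [-> _|] := eqVneq j k; first exact/ideal_genMl/edge_binomial.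
rewrite addn_gt0 => /orP[] /mnm_factor[m' Em].
- have Ls : L ('X_[m' + U_(uidx i)] * (u k * w j + w k * u j)).
    apply: IHs => l /Tm; rewrite Em !vdegD !vdeg_uidx; lia.
  rewrite Em mpolyXD.
  suff -> : 'X_[m'] * u k * (u i * w j + w i * u j) =
      'X_[m' + U_(uidx i)] * (u k * w j + w k * u j) +
      'X_[m'] * u j * (u i * w k + w i * u k).
    by apply: ideal_genD Ls _; apply/ideal_genMl/edge_binomial.
  by rewrite mpolyXD; apply: (@eqD_char2 _ _ ('X_[m'] * u i * u j * w k)); ring.
- have Ls : L ('X_[m' + U_(widx i)] * (u k * w j + w k * u j)).
    apply: IHs => l /Tm; rewrite Em !vdegD !vdeg_widx; lia.
  rewrite Em mpolyXD.
  suff -> : 'X_[m'] * w k * (u i * w j + w i * u j) =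
      'X_[m' + U_(widx i)] * (u k * w j + w k * u j) +
      'X_[m'] * w j * (u i * w k + w i * u k).
    by apply: ideal_genD Ls _; apply/ideal_genMl/edge_binomial.
  by rewrite mpolyXD; apply: (@eqD_char2 _ _ ('X_[m'] * w i * w j * u k)); ring.
Qed.

(** Induction on the excess of the u-tokens of m over those of m': a vertex i with
    too many is compensated in its component by a vertex j with too few, and the
    exchange between i and j lowers the excess. *)
Lemma monomial_congr m m' :
    (forall i, vdeg m i = vdeg m' i) ->
    (forall c, \sum_(i | component (vsupp m) i == c) m (uidx i) =
               \sum_(i | component (vsupp m) i == c) m' (uidx i))%N ->
  L ('X_[m] + 'X_[m']).
Proof.
move: {2}_.+1 (ltnSn (\sum_i (m (uidx i) - m' (uidx i)))) => N.
elim: N m => // N IHN m ltN degE sumE.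
have [i lti | le] := pickP (fun i => m' (uidx i) < m (uidx i))%N; last first.
  have mU i : m (uidx i) = m' (uidx i).
    apply/eqP; rewrite eqn_leq leqNgt le /= leqNgt; apply/negP => lti.
    have [j _] := sum_eq_ltn_exists (sumE _) (eqxx _) lti.
    by rewrite le.
  suff -> : m = m' by rewrite (mpolyDD_char2 hK); apply: ideal_gen0.
  apply/mnmP => k; have [-> | ->] := uidx_or_widx k; first exact: mU.
  by have := degE (vertex k); rewrite /vdeg mU => /addnI.
have [j cij ltj] := sum_eq_ltn_exists (esym (sumE _)) (eqxx _) lti.
have mWj : (0 < m (widx j))%N by have := degE j; rewrite /vdeg; lia.
have nij : i != j by apply: contraTneq ltj => <-; rewrite -leqNgt ltnW.
have [m1 Em1] := mnm_factor mWj.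
have m1Ui : (0 < m1 (uidx i))%N.
  by move: lti; rewrite Em1 mnmDE mnm1E eq_wu addn0; lia.
have [m0 Em0] := mnm_factor m1Ui; rewrite {m1 m1Ui}Em0 in Em1.
(* m = m0 u_i w_j is exchanged with m2 = m0 w_i u_j. *)
have [m2 Em2] : exists m2, m2 = (m0 + U_(widx i) + U_(uidx j))%MM by eexists.
have deg2 l : vdeg m2 l = vdeg m l.
  by rewrite Em1 Em2 !vdegD !vdeg_uidx !vdeg_widx.
have supp2 : vsupp m2 = vsupp m by apply/setP => l; rewrite !inE deg2.
have m2U l : (m2 (uidx l) + (i == l) = m (uidx l) + (j == l))%N.
  by rewrite Em1 Em2 !mnmDE !mnm1E !eq_uu !eq_wu !addn0 addnAC.
have Lswap : L ('X_[m] + 'X_[m2]).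
  have -> : 'X_[m] + 'X_[m2] = 'X_[m0] * (u i * w j + w i * u j).
    by rewrite Em1 Em2 !mpolyXD mulrDr !mulrA.
  apply: (@path_binomial (vsupp m)).
    by rewrite -(root_connect (induced_sym _)) eq_sym.
  by move=> l; rewrite inE Em1 !vdegD vdeg_uidx vdeg_widx.
have L2 : L ('X_[m2] + 'X_[m']).
  apply: IHN => [|l|c]; last 2 first.
  - by rewrite deg2.
  - rewrite supp2 -sumE; apply/eqP.
    rewrite -(eqn_add2r (\sum_(l | component (vsupp m) l == c) (i == l))).
    rewrite -big_split /=.
    under eq_bigr do rewrite m2U.
    rewrite big_split /= eqn_add2l.
    have sum1 v : (\sum_(l | component (vsupp m) l == c) (v == l) =
        (component (vsupp m) v == c))%N.
      rewrite big_mkcond (bigD1 v) //= eqxx big1 ?addn0; first by case: ifP.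
      by move=> l /negPf; rewrite eq_sym => ->; case: ifP.
    by rewrite !sum1 (eqP cij).
  - rewrite ltnS in ltN; apply: leq_trans ltN.
    rewrite (bigD1 i) //= [ltnRHS](bigD1 i) //= -addSn; apply: leq_add.
      have := m2U i; rewrite eqxx eq_sym (negPf nij); lia.
    apply: leq_sum => l nil; have := m2U l; rewrite eq_sym (negPf nil).
    have [<-|_] := eqVneq j l; lia.
have -> : 'X_[m] + 'X_[m'] = ('X_[m] + 'X_[m2]) + ('X_[m2] + 'X_[m']) :> P.
  by apply: (@eqD_char2 _ _ 'X_[m2]); ring.
exact: ideal_genD.
Qed.

(** The exponents of phi_T on one variable, for T containing its vertex.  The
    target reuses the ring of the source: y_i plays t_i, counting the tokens on i,
    and x_c plays a_C where c encodes the component C, counting its u-tokens. *)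
Definition weight T k : M :=
  (U_(rshift n (vertex k)) +
   if k == uidx (vertex k) then U_(lshift n (component T (vertex k))) else 0)%MM.

(** The exponents of phi_T on a monomial. *)
Definition key T m : M := (\sum_k weight T k *+ m k)%MM.

Definition param T k : P := if vertex k \in T then 'X_[weight T k] else 0.

Local Notation phi T := (mmap (@mpolyC (n + n) K) (param T)).

Lemma key_rshift T m i : key T m (rshift n i) = vdeg m i.
Proof.
rewrite /key mnm_sumE big_uw (bigD1 i) //= big1 ?addn0 => [|j nij];
  rewrite /weight !mulmnE !vertex_uidx !vertex_widx !eqxx !eq_wu
    !mnmDE !mnm1E eq_lrshift mnm0E.
  by rewrite eqxx !addn0 !mul1n.
by rewrite eq_rshift (negPf nij).
Qed.

Lemma key_lshift T m c :
  key T m (lshift n c) = (\sum_(i | component T i == c) m (uidx i))%N.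
Proof.
rewrite /key mnm_sumE big_uw [RHS]big_mkcond; apply: eq_bigr => i _ /=.
rewrite /weight !mulmnE !vertex_uidx !vertex_widx !eqxx !eq_wu
  !mnmDE !mnm1E mnm0E eq_rlshift.
by rewrite eq_lshift addn0; case: eqP => _; rewrite ?mul1n ?addn0.
Qed.

Lemma phi_monomial T m :
  phi T 'X_[m] = if vsupp m \subset T then 'X_[key T m] else 0.
Proof.
rewrite mmapX /mmap1; case: ifPn => [/subsetP sub | /subsetPn[i]].
  rewrite /key (big_morph _ (@mpolyXD _ _) (@mpolyX0 _ _)).
  apply: eq_bigr => k _.
  have [->|mk] := posnP (m k); first by rewrite expr0 mulm0n mpolyX0.
  rewrite /param sub ?mpolyXn // inE.
  by have [E|E] := uidx_or_widx k; rewrite /vdeg -E addn_gt0 mk ?orbT.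
rewrite inE addn_gt0 => /orP[] mi niT.
  rewrite (bigD1 (uidx i)) //= /param vertex_uidx (negPf niT).
  by rewrite expr0n -[_ == _]leqn0 leqNgt mi mul0r.
rewrite (bigD1 (widx i)) //= /param vertex_widx (negPf niT).
by rewrite expr0n -[_ == _]leqn0 leqNgt mi mul0r.
Qed.

Lemma phi_L0 T p : L p -> phi T p = 0.
Proof.
suff phi_edge f : (exists i j, G i j /\ f = edge_poly K i j) ->
    exists d, phi T f = d * 0.
  by move/(ideal_gen_rmorph_dvd phi_edge) => [d ->]; rewrite mulr0.
case=> i [j [Gij ->]]; exists 0; rewrite mulr0.
rewrite edge_polyE // rmorphD !rmorphM /= !mmapX !mmap1U /param
  !vertex_uidx !vertex_widx.
case: (boolP (i \in T)) => iT; last by rewrite !mul0r addr0.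
case: (boolP (j \in T)) => jT; last by rewrite !mulr0 addr0.
have cij : component T i = component T j.
  apply/eqP; rewrite root_connect; last exact: induced_sym.
  by apply: connect1; rewrite /induced /= Gij iT.
rewrite /weight !vertex_uidx !vertex_widx !eqxx !eq_wu cij !addm0 !mpolyXD.
by rewrite mulrAC -mulrA (mpolyDD_char2 hK).
Qed.

(** The monomials of p fall into classes congruent modulo L_G, and the sum of the
    coefficients of p over a class is a coefficient of phi_T p, where T is the
    common support of the class.  All these sums vanish, so p is congruent to 0
    once each monomial is replaced by a representative of its class. *)
Lemma mem_L_of_phi0 p : (forall T, phi T p = 0) -> L p.
Proof.
move=> phi0; pose skey m := key (vsupp m) m.
have skeyP m m' : skey m = skey m' -> L ('X_[m] + 'X_[m']).
  rewrite /skey => E; have degE i : vdeg m i = vdeg m' i.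
    by rewrite -(key_rshift (vsupp m)) E key_rshift.
  have suppE : vsupp m = vsupp m' by apply/setP => i; rewrite !inE degE.
  rewrite -suppE in E; apply: monomial_congr => // c.
  by rewrite -[LHS]key_lshift -[RHS]key_lshift E.
have coef0 e : \sum_(m <- msupp p | skey m == e) p@_m = 0.
  (* The exponents of the t_i in e tell which T to use. *)
  pose T := [set i | (0 < e (rshift n i))%N].
  transitivity (phi T p)@_e; last by rewrite phi0 mcoeff0.
  rewrite [in RHS](mpolyE p) (raddf_sum (phi T)) (raddf_sum (mcoeff e)) /=.
  rewrite big_mkcond; apply: eq_bigr => m _.
  rewrite mmapZ phi_monomial mcoeffCM.
  have [Em|nEm] := eqVneq (skey m) e.
    have -> : T = vsupp m by apply/setP => i; rewrite !inE -Em key_rshift.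
    by rewrite subxx mcoeffX -/(skey m) Em eqxx mulr1.
  case: ifP => [_|]; last by rewrite mcoeff0 mulr0.
  rewrite mcoeffX; have [Em|] := eqVneq (key T m) e; last by rewrite mulr0.
  have TE : T = vsupp m by apply/setP => i; rewrite !inE -Em key_rshift.
  by move: nEm; rewrite /skey -TE Em eqxx.
pose rep e := nth 0%MM (msupp p) (find (fun m => skey m == e) (msupp p)).
have repP m : m \in msupp p -> skey (rep (skey m)) = skey m.
  move=> pm; apply/eqP; apply: (@nth_find _ _ (fun m' => skey m' == skey m)).
  by apply/hasP; exists m.
have rep0 : \sum_(m <- msupp p) p@_m *: 'X_[rep (skey m)] = 0 :> P.
  rewrite (sum_by_image _ _ skey) big1 // => e _.
  rewrite (eq_bigr (fun m => p@_m *: 'X_[rep e])) => [|m /eqP -> //].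
  by rewrite -scaler_suml coef0 scale0r.
have -> : p = \sum_(m <- msupp p) p@_m *: ('X_[m] + 'X_[rep (skey m)]).
  under eq_bigr do rewrite scalerDr.
  by rewrite big_split /= rep0 addr0 -mpolyE.
apply: ideal_gen_sum => m pm; rewrite -mul_mpolyC; apply: ideal_genMl.
by apply: skeyP; rewrite repP.
Qed.

End Bipartite.

Theorem theorem1p2 (n : nat) (G : rel 'I_n) (K : fieldType)
    (hG : simple_graph G) (hK : 2%N \in [pchar K]) :
  radical_ideal (L_ideal K G) <-> bipartite G.
Proof.
split=> [radL | [A hA] p k Lpk].
  exact/(no_odd_walk_bipartite hG)/(radical_no_odd_walk hK radL).
apply: (mem_L_of_phi0 hG hK hA) => T; apply/eqP.
have := phi_L0 hG hK hA T Lpk; rewrite rmorphXn => /eqP.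
by rewrite expf_eq0 => /andP[].
Qed.
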